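(* Let $q$ be a stable natural number and $\eta=\delta(q)+k$ with $k\in\mathbb{Z}_{\ge0}$. Then $\eta\in\overline{\mathscr{D}^{\|q\|+k}_{\mathrm{st}}}$. Moreover, if $\eta=\overline{\mathscr{D}_{\mathrm{st}}}(\alpha)$, then $\operatorname{ord}\alpha=k$; and if $\eta=\overline{\mathscr{D}^{\|q\|+k}_{\mathrm{st}}}(\beta)$, then $\operatorname{ord}\beta=k$.
   Context: $\|n\|$ denotes the integer complexity of $n\in\mathbb{N}$ (least number of $1$'s needed to write $n$ using $1$, $+$, $\cdot$ and parentheses), and $\delta(n)=\|n\|-3\log_3 n$. $n$ is stable if $\|3^kn\|=3k+\|n\|$ for all $k\ge0$. $\mathscr{D}_{\mathrm{st}}=\{\delta(n):n\text{ stable}\}$; for a congruence class $u$ mod $3$, $\mathscr{D}^u_{\mathrm{st}}=\{\delta(n):n>1\text{ stable},\ \|n\|\equiv u\pmod 3\}$. Overlines denote closures in $\mathbb{R}$ (these are well-ordered). For a well-ordered set $S$ and ordinal $\gamma$, $S[\gamma]$ is the element of $S$ whose set of predecessors has order type $\gamma$, and for $\alpha\ge1$, $S(\alpha)=S[\gamma]$ where $1+\gamma=\alpha$. For an ordinal $\alpha>0$ with Cantor normal form $\omega^{\alpha_0}a_0+\cdots+\omega^{\alpha_r}a_r$ ($\alpha_0>\cdots>\alpha_r$, $a_i\ge1$), $\operatorname{ord}\alpha=\alpha_r$. *)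

(* Defs.v *)
From HB Require Import structures.
From mathcomp Require Import all_boot all_order all_algebra.
From mathcomp Require Import all_classical all_reals all_analysis.
Set Implicit Arguments.
Unset Strict Implicit.
Unset Printing Implicit Defensive.
Import Order.TTheory GRing.Theory Num.Theory.
Import numFieldNormedType.Exports.
Local Open Scope classical_set_scope.
Local Open Scope ring_scope.

Inductive expr : Type :=
| One
| Add of expr & expr
| Mul of expr & expr.

Fixpoint value (e : expr) : nat :=
  match e with
  | One => 1
  | Add e1 e2 => (value e1 + value e2)%N
  | Mul e1 e2 => (value e1 * value e2)%N
  end.

Fixpoint ones (e : expr) : nat :=
  match e with
  | One => 1
  | Add e1 e2 | Mul e1 e2 => (ones e1 + ones e2)%N
  end.

Definition writable (n c : nat) : bool :=
  `[< exists e, value e = n /\ ones e = c >].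

(* No expression has value 0; complexity 0 is the junk value 0. *)
Definition complexity (n : nat) : nat :=
  if pselect (exists c, writable n c) is left ex then ex_minn ex else 0%N.

Definition stable (n : nat) : Prop :=
  (0 < n)%N /\
  forall k : nat, complexity (3 ^ k * n)%N = (3 * k + complexity n)%N.

Definition defect (R : realType) (n : nat) : R :=
  (complexity n)%:R - 3 * (ln n%:R / ln 3).

Definition Dst (R : realType) : set R :=
  [set x | exists n, stable n /\ x = defect R n].
Arguments Dst : clear implicits.

(* The congruence class mod 3 is given by any natural representative u. *)
Definition Dst_mod (R : realType) (u : nat) : set R :=
  [set x | exists n, [/\ (1 < n)%N, stable n,
     complexity n = u %[mod 3] & x = defect R n]].
Arguments Dst_mod : clear implicits.

(* Ordinals as well-founded trees: osup f denotes the least ordinal strictly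
   above every f i. Distinct trees may denote the same ordinal, so equality of
   ordinals is oeq, not Leibniz equality. *)
Inductive Ord : Type := osup (A : Type) of (A -> Ord).

Fixpoint ole (a b : Ord) {struct a} : Prop :=
  let: osup A f := a in let: osup B g := b in
  forall i, exists j, ole (f i) (g j).

Definition olt (a b : Ord) : Prop :=
  let: osup B g := b in exists j, ole a (g j).

Definition oeq (a b : Ord) : Prop := ole a b /\ ole b a.

Definition ozero : Ord := osup (fun x : void => match x with end).

Definition osucc (a : Ord) : Ord := osup (fun _ : unit => a).

Definition ofin (n : nat) : Ord := iter n osucc ozero.

(* a + b is the least ordinal strictly above every a' < a and every a + b'
   with b' < b; a * b is the least strictly above every a * b' + a'. *)
Fixpoint oadd (a b : Ord) {struct b} : Ord :=
  let: osup A f := a in let: osup B g := b in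
  osup (fun x : (A + B)%type =>
    match x with inl i => f i | inr j => oadd a (g j) end).

Fixpoint omul (a b : Ord) {struct b} : Ord :=
  let: osup A f := a in let: osup B g := b in
  osup (fun x : (A * B)%type => oadd (omul a (g x.2)) (f x.1)).

(* omega ^ b is the least ordinal above 0 and above every
   omega ^ b' * n with b' < b and n finite. *)
Fixpoint oomega_exp (b : Ord) : Ord :=
  let: osup B g := b in
  osup (fun x : option (B * nat) =>
    if x is Some (j, n) then omul (oomega_exp (g j)) (ofin n) else ozero).

(* The list [:: (e_0, a_0); ...; (e_r, a_r)] encodes
   omega ^ e_0 * a_0 + ... + omega ^ e_r * a_r. *)
Fixpoint cnf_value (s : seq (Ord * nat)) : Ord :=
  if s is (e, a) :: s' then
    oadd (omul (oomega_exp e) (ofin a)) (cnf_value s')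
  else ozero.

Fixpoint is_cnf (s : seq (Ord * nat)) : Prop :=
  if s is (e, a) :: s' then
    [/\ (0 < a)%N, (if s' is (e', _) :: _ then olt e' e else True)
      & is_cnf s']
  else True.

(* "ord alpha = beta"; it holds for no beta when alpha = 0. *)
Definition ord_is (alpha beta : Ord) : Prop :=
  exists (s : seq (Ord * nat)) (e : Ord) (a : nat),
    [/\ is_cnf (rcons s (e, a)), oeq alpha (cnf_value (rcons s (e, a)))
      & oeq beta e].

(* f is an order isomorphism from A onto the ordinals below gamma. *)
Definition has_order_type (R : realType) (A : set R) (gamma : Ord) : Prop :=
  exists f : R -> Ord,
    (forall x y, A x -> A y -> (x < y <-> olt (f x) (f y))) /\
    (forall b, olt b gamma <-> exists2 x, A x & oeq (f x) b).

(* x = S[gamma] *)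
Definition is_nth0 (R : realType) (S : set R) (gamma : Ord) (x : R) : Prop :=
  S x /\ has_order_type (S `&` [set y | y < x]) gamma.

(* x = S(alpha) *)
Definition is_nth1 (R : realType) (S : set R) (alpha : Ord) (x : R) : Prop :=
  exists2 gamma, oeq (oadd (ofin 1) gamma) alpha & is_nth0 S gamma x.

(* Main.v *)
(** A shortest expression of a number of defect at most [r] is a product of
  a power of 3 and of boundedly many other factors [a + b], with [b <= a] and
  [b] bounded. Unless [a] is also bounded,
  dropping [b] hardly changes the number but lowers its complexity. Hence, if
  stable defects accumulate at [x], then [x - c] is a limit of stable defects
  for some integer [c > 0], and every point of the closure is
  [delta(m) + j] with [m] stable; here [j] is unique, by 3-adic valuation.
  Consequently [3 ^ t * q + 1], up to a power of 3, has for large [t] a stable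
  defect slightly below [delta(q) + 1], as a smaller complexity would produce
  the limit point [delta(q) + 1 - s] with [s > 0]. Iterating these two facts,
  [delta(q) + k] has Cantor-Bendixson rank exactly [k], and this rank is the
  last exponent in the Cantor normal form of its position. *)
Require Import Defs.
From mathcomp Require Import all_boot all_order all_algebra.
From mathcomp Require Import all_classical all_reals all_analysis.
From mathcomp Require Import zify ring lra.
Import Order.TTheory GRing.Theory Num.Theory.
Import numFieldNormedType.Exports.
Local Open Scope classical_set_scope.
Local Open Scope ring_scope.

(** * Ordinals *)

Lemma oleP A (f : A -> Ord) b : ole (osup f) b <-> forall i, olt (f i) b.
Proof. by case: b. Qed.

Lemma ole_refl a : ole a a.
Proof. by elim: a => A f IH /= i; exists i. Qed.

Lemma ole_trans b a c : ole a b -> ole b c -> ole a c.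
Proof.
elim: a b c => A f IH [B g] [C h] /= ab bc i.
have [j fg] := ab i; have [k gh] := bc j.
by exists k; apply: IH fg gh.
Qed.

Lemma ole_lt_trans b a c : ole a b -> olt b c -> olt a c.
Proof. by case: c => C h ab [k bh]; exists k; apply: ole_trans bh. Qed.

Lemma olt_le_trans b a c : olt a b -> ole b c -> olt a c.
Proof.
case: b => B g [j aj] /oleP bc; exact: ole_lt_trans (bc j).
Qed.

Lemma oltW a b : olt a b -> ole a b.
Proof.
elim: a b => A f IH [B g] [j aj]; apply/oleP => i; exists j.
by apply: IH; apply: olt_le_trans aj; exists i; exact: ole_refl.
Qed.

Lemma olt_trans b a c : olt a b -> olt b c -> olt a c.
Proof. by move=> /oltW; exact: ole_lt_trans. Qed.

Lemma ole_total a b : ole a b \/ olt b a.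
Proof.
elim: a b => A f IH [B g].
have [ab|] := pselect (ole (osup f) (osup g)); first by left.
move=> /existsNP[i nab]; right; exists i; apply/oleP => j.
by have [fg|//] := IH i (g j); case: nab; exists j.
Qed.

Lemma olt_wf : well_founded olt.
Proof.
(* Distinct trees can denote the same ordinal, so the structural induction has to cover every [b]
   below [a]. *)
move=> a; suff: forall b, ole b a -> Acc olt b by apply; exact: ole_refl.
elim: a => A f IH b ba; constructor => c cb.
by have [i ci] := olt_le_trans _ _ _ cb ba; exact: IH ci.
Qed.

Lemma olt_irr a : ~ olt a a.
Proof. by elim: (olt_wf a) => {}a _ IH aa; exact: (IH a aa aa). Qed.

Lemma ole_ltF a b : ole a b -> ~ olt b a.
Proof. by move=> ab ba; exact: olt_irr (ole_lt_trans _ _ _ ab ba). Qed.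

Lemma ole_eqVlt a b : ole a b -> oeq a b \/ olt a b.
Proof. by move=> ab; have [ba|] := ole_total b a; [left | right]. Qed.

Lemma oeq_refl a : oeq a a.
Proof. by split; exact: ole_refl. Qed.

Lemma oeq_sym a b : oeq a b -> oeq b a.
Proof. by case. Qed.

Lemma oeq_trans b a c : oeq a b -> oeq b c -> oeq a c.
Proof.
by move=> [ab ba] [bc cb]; split; [exact: ole_trans bc | exact: ole_trans ba].
Qed.

Lemma ole0 a : ole ozero a.
Proof. by apply/oleP; case. Qed.

Lemma olt_ext_le a b : (forall x, olt x a -> olt x b) -> ole a b.
Proof.
by move=> ab; have [//|/[dup] ba /ab /olt_irr] := ole_total a b.
Qed.

Lemma olt0 a : ~ olt a ozero.
Proof. by case. Qed.

Lemma oeq0Vlt a : oeq a ozero \/ olt ozero a.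
Proof.
by have [/oeq_sym|] := ole_eqVlt _ _ (ole0 a); [left | right].
Qed.

Lemma oltS a : olt a (osucc a).
Proof. by exists tt; exact: ole_refl. Qed.

Lemma ofin_lt i j : (i < j)%N -> olt (ofin i) (ofin j).
Proof.
elim: j => // j IH; rewrite ltnS leq_eqVlt => /predU1P[->|/IH ij].
  exact: oltS.
exact: olt_trans ij (oltS _).
Qed.

(** * Ordinal arithmetic *)

Lemma ole_addl a b : ole a (oadd a b).
Proof.
by case: a b => A f [B g]; apply/oleP => i; exists (inl i); exact: ole_refl.
Qed.

Lemma ole_add2l a b c : ole b c -> ole (oadd a b) (oadd a c).
Proof.
elim: b a c => B g IH [A f] [C h] /oleP bc; apply/oleP => -[i|j].
  by exists (inl i); exact: ole_refl.
by have [k jk] := bc j; exists (inr k); exact: IH.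
Qed.

Lemma olt_add2l a b c : olt b c -> olt (oadd a b) (oadd a c).
Proof.
by case: a c => A f [C h] [k bk]; exists (inr k); exact: ole_add2l.
Qed.

Lemma ole_add2r a b c : ole b c -> ole (oadd b a) (oadd c a).
Proof.
elim: a b c => A f IH [B g] c bc; apply/oleP => -[i|j].
  by apply: olt_le_trans (ole_addl _ _); apply: olt_le_trans bc; exists i;
     exact: ole_refl.
by case: c bc => C h bc; exists (inr j); exact: IH.
Qed.

Lemma oadd_eq a a' b b' : oeq a a' -> oeq b b' -> oeq (oadd a b) (oadd a' b').
Proof.
move=> [aa a'a] [bb b'b]; split.
  by apply: ole_trans (ole_add2l _ _ _ bb); exact: ole_add2r.
by apply: ole_trans (ole_add2l _ _ _ b'b); exact: ole_add2r.
Qed.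

Lemma oadd0 a : oeq (oadd a ozero) a.
Proof.
split; last exact: ole_addl.
by case: a => A f; apply/oleP => -[i|[]]; exists i; exact: ole_refl.
Qed.

Lemma add0o a : oeq (oadd ozero a) a.
Proof.
elim: a => A f IH; split; apply/oleP.
  by move=> [[]|i]; exists i; case: (IH i).
by move=> i; exists (inr i); case: (IH i).
Qed.

Lemma oaddA a b c : oeq (oadd a (oadd b c)) (oadd (oadd a b) c).
Proof.
elim: c a b => C h IH [A f] [B g]; split; apply/oleP.
- move=> [i|[j|k]].
  + by exists (inl (inl i)); exact: ole_refl.
  + by exists (inl (inr j)); exact: ole_refl.
  + by exists (inr k); case: (IH k (osup f) (osup g)).
- move=> [[i|j]|k].
  + by exists (inl i); exact: ole_refl.
  + by exists (inr (inl j)); exact: ole_refl.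
  + by exists (inr (inr k)); case: (IH k (osup f) (osup g)).
Qed.

(** Stands in for left subtraction of [a]. *)
Lemma olt_addP x a b :
  olt x (oadd a b) -> olt x a \/ exists2 y, olt y b & oeq x (oadd a y).
Proof.
elim: b x => B g IH x; case: a IH => A f IH [[i xi|j xj]].
  by left; exists i.
have [xj'|/IH [|[y yj xy]]] := ole_eqVlt _ _ xj.
- by right; exists (g j) => //; exists j; exact: ole_refl.
- by left.
- by right; exists y => //; exists j; exact: oltW.
Qed.

Lemma omul0 a : oeq (omul a ozero) ozero.
Proof. by case: a => A f; split; apply/oleP => -[]. Qed.

Lemma omulS a b : olt ozero a ->
  oeq (omul a (osucc b)) (oadd (omul a b) a).
Proof.
case: a => A f [i0 _]; split.
  change (ole (osup (fun x : A * unit => oadd (omul (osup f) b) (f x.1)))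
    (oadd (omul (osup f) b) (osup f))).
  by apply/oleP => -[i []]; apply: olt_add2l; exists i; exact: ole_refl.
apply: olt_ext_le => x /olt_addP[xb|[y [i yi] [xy _]]].
  (* Any index of [a] serves here; [0 < a] provides one. *)
  by exists (i0, tt) => /=; apply: oltW; apply: olt_le_trans xb (ole_addl _ _).
exists (i, tt) => /=; apply: ole_trans xy _; exact: ole_add2l.
Qed.

Lemma omega_exp_gt0 e : olt ozero (oomega_exp e).
Proof. by case: e => E g; exists None; exact: ole_refl. Qed.

Lemma omegaM1 e : oeq (omul (oomega_exp e) (ofin 1)) (oomega_exp e).
Proof.
apply: oeq_trans (omulS _ (ofin 0) (omega_exp_gt0 e)) _.
exact: oeq_trans (oadd_eq _ _ _ _ (omul0 _) (oeq_refl _)) (add0o _).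
Qed.

(** * Limit rank *)

(* [limit_rank j] holds at the ordinals divisible by omega ^ j, except that
   0 only counts for [j = 0]; equivalently, at the points of Cantor-Bendixson
   rank at least [j] in the order topology. *)
Fixpoint limit_rank (j : nat) (a : Ord) : Prop :=
  if j is j'.+1 then
    olt ozero a /\
    forall b, olt b a -> exists m, [/\ olt b m, olt m a & limit_rank j' m]
  else True.

Lemma limit_rank_eq j a b : oeq a b -> limit_rank j a -> limit_rank j b.
Proof.
case: j => //= j [ab ba] [a0 lima]; split; first exact: olt_le_trans ab.
move=> c cb; have [m [cm ma jm]] := lima c (olt_le_trans _ _ _ cb ba).
by exists m; split=> //; exact: olt_le_trans ab.
Qed.

Lemma limit_rankW j a : limit_rank j.+1 a -> limit_rank j a.
Proof.
elim: j a => // j IH a [a0 lima]; split=> // b ba.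
by have [m [bm ma /IH jm]] := lima b ba; exists m.
Qed.

Lemma limit_rank_le i j a : (i <= j)%N -> limit_rank j a -> limit_rank i a.
Proof.
move=> ij; rewrite -(subnK ij); elim: (j - i)%N => // n IH.
by rewrite addSn => /limit_rankW.
Qed.

(** From [a] on, the ordinals below [a + b] are the translates [a + y] with [y < b], so
    approximations from below to [a + b] and to [b] correspond. At [b = 0] the rank would be that of
    [a]. *)
Lemma limit_rank_add j a b : olt ozero b ->
  limit_rank j (oadd a b) <-> limit_rank j b.
Proof.
elim: j b => // j IH b b0; split=> -[_ lim]; split=> //.
- move=> x xb; have [m [xm mb jm]] := lim _ (olt_add2l a _ _ xb).
  have [ma|[y yb my]] := olt_addP _ _ _ mb.
    by case: (ole_ltF _ _ (ole_addl a x)); exact: olt_trans ma.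
  have [yx|xy] := ole_total y x.
    case: (@ole_ltF m (oadd a x)) => //.
    by apply: ole_trans (ole_add2l _ _ _ yx); case: my.
  exists y; split=> //; apply/(IH y); first exact: ole_lt_trans (ole0 x) xy.
  exact: limit_rank_eq jm.
- exact: ole_lt_trans (ole0 _) (olt_add2l a _ _ b0).
- move=> x /olt_addP xab.
  have [x' x'b xx'] : exists2 x', olt x' b & ole x (oadd a x').
    case: xab => [xa|[y yb [xy _]]]; last by exists y.
    exists ozero => //; apply: oltW; apply: olt_le_trans xa _.
    exact: ole_addl.
  have [m [x'm mb jm]] := lim x' x'b; exists (oadd a m).
  split; [|exact: olt_add2l|].
    by apply: ole_lt_trans xx' _; exact: olt_add2l.
  by apply/(IH m) => //; exact: ole_lt_trans (ole0 _) x'm.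
Qed.

(** Serves the shift [alpha = 1 + gamma] between the two indexings. At [a = 0] the sum is 1, and
    nothing lies strictly between 0 and 1. *)
Lemma limit_rank_succ j a : limit_rank j (oadd (ofin 1) a) -> limit_rank j a.
Proof.
case: j => // j; have [a0|a0] := oeq0Vlt a; last by move/limit_rank_add; apply.
move=> j1.
have {}j1 : limit_rank j.+1 (ofin 1).
  apply: limit_rank_eq j1.
  exact: oeq_trans (oadd_eq _ _ _ _ (oeq_refl _) a0) (oadd0 _).
have [|m [m0 [_ m1] _]] := j1.2 ozero; first exact: oltS.
by case: (ole_ltF _ _ m1).
Qed.

Lemma succ_limit_rank j a : limit_rank j a -> limit_rank j (oadd (ofin 1) a).
Proof. by case: j => // j ja; apply/limit_rank_add => //; case: ja. Qed.

(** The multiples [omega ^ j * n.+1] are cofinal in [omega ^ j.+1], and their last summand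
    [omega ^ j] gives them rank [j]. *)
Lemma limit_rank_omega j : limit_rank j (oomega_exp (ofin j)).
Proof.
elim: j => // j IH; split; first exact: omega_exp_gt0.
have limM n : limit_rank j (omul (oomega_exp (ofin j)) (ofin n.+1)).
  apply: limit_rank_eq (oeq_sym _ _ (omulS _ (ofin n) (omega_exp_gt0 _))) _.
  by apply/limit_rank_add => //; exact: omega_exp_gt0.
have ltM n : olt (omul (oomega_exp (ofin j)) (ofin n))
                 (omul (oomega_exp (ofin j)) (ofin n.+1)).
  apply: olt_le_trans (omulS _ (ofin n) (omega_exp_gt0 _)).2.
  apply: ole_lt_trans (oadd0 _).2 _.
  by apply: olt_add2l; exact: omega_exp_gt0.
move=> b [[[[] n]|] bn].
  exists (omul (oomega_exp (ofin j)) (ofin n.+1)); split=> //.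
    exact: ole_lt_trans bn (ltM n).
  by exists (Some (tt, n.+1)); exact: ole_refl.
exists (omul (oomega_exp (ofin j)) (ofin 1)); split=> //.
  apply: ole_lt_trans bn _; apply: olt_le_trans (omegaM1 _).2.
  exact: omega_exp_gt0.
by exists (Some (tt, 1%N)); exact: ole_refl.
Qed.

(** Below [omega ^ j.+1], some [omega ^ j * n] bounds [a]. Induction on [n] leaves a last summand
    [y] with [0 < y <= omega ^ j], which inherits the rank of [a]. Rank [j.+1] there would put an
    ordinal of rank [j] strictly between 0 and [omega ^ j]. *)
Lemma limit_rank_lt_omega j a : olt ozero a -> olt a (oomega_exp (ofin j)) ->
  ~ limit_rank j a.
Proof.
elim: j a => [|j IH] a a0.
  by case=> -[[[]]|] // a0'; case: (ole_ltF _ _ a0').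
case=> -[[[] n]|] an; last by case: (ole_ltF _ _ an).
elim: n a a0 an => [|n IHn] a a0 /= an.
  have /ole_ltF := ole_trans _ _ _ an (omul0 _).1; exact.
have {}an := ole_trans _ _ _ an (omulS _ (ofin n) (omega_exp_gt0 _)).1.
have nlim : ~ limit_rank j.+1 (oomega_exp (ofin j)).
  by case=> w0 /(_ _ w0)[m [m0 mw]]; exact: IH.
have [aE|alt] := ole_eqVlt _ _ an.
  move=> a1; have {a1}ja := limit_rank_eq j.+1 _ _ aE a1; apply: nlim.
  exact: (limit_rank_add _ _ _ (omega_exp_gt0 _)).1 ja.
have [/oltW /(IHn _ a0)//|[y yw aE]] := olt_addP _ _ _ alt.
have [y0|y0] := oeq0Vlt y.
  apply: IHn => //.
  have := oeq_trans _ _ _ aE (oadd_eq _ _ _ _ (oeq_refl _) y0).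
  by move=> /oeq_trans /(_ (oadd0 _)) [].
move=> a1; have {a1}ja := limit_rank_eq j.+1 _ _ aE a1; apply: (IH y) => //.
exact: limit_rankW ((limit_rank_add _ _ _ y0).1 ja).
Qed.

(* Both sides are the least ordinal above [b] of limit rank at least [j]. *)
Lemma limit_rank_next j a b : olt b a -> limit_rank j a ->
  (forall m, olt b m -> olt m a -> ~ limit_rank j m) ->
  oeq a (oadd b (oomega_exp (ofin j))).
Proof.
move=> ba ja nj; have w0 := omega_exp_gt0 (ofin j).
have jbw : limit_rank j (oadd b (oomega_exp (ofin j))).
  by apply/limit_rank_add => //; exact: limit_rank_omega.
have bw : olt b (oadd b (oomega_exp (ofin j))).
  by apply: ole_lt_trans (oadd0 b).2 _; exact: olt_add2l.
split.
  by have [//|/nj] := ole_total a (oadd b (oomega_exp (ofin j))); case.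
have [//|alt] := ole_total (oadd b (oomega_exp (ofin j))) a.
have [/(olt_trans _ _ _ ba)/olt_irr//|[y yw aE]] := olt_addP _ _ _ alt.
have [y0|y0] := oeq0Vlt y.
  case: (@ole_ltF a b) => //.
  have := oeq_trans _ _ _ aE (oadd_eq _ _ _ _ (oeq_refl _) y0).
  by move=> /oeq_trans /(_ (oadd0 _)) [].
case: (limit_rank_lt_omega j y) => //; apply/(limit_rank_add _ b) => //.
exact: limit_rank_eq ja.
Qed.

(** * From limit rank to the last exponent of the Cantor normal form *)

Lemma cnf_value_rcons s e n : oeq (cnf_value (rcons s (e, n)))
  (oadd (cnf_value s) (omul (oomega_exp e) (ofin n))).
Proof.
elim: s => [|[e' n'] s IH] /=.
  exact: oeq_trans (oadd0 _) (oeq_sym _ _ (add0o _)).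
exact: oeq_trans (oadd_eq _ _ _ _ (oeq_refl _) IH) (oaddA _ _ _).
Qed.

Lemma is_cnf_rconsS s e n :
  is_cnf (rcons s (e, n)) -> is_cnf (rcons s (e, n.+1)).
Proof.
elim: s => [|[e' n'] s IH] /=; first by case.
by case: s IH => [|[e2 n2] s] IH [n'0 ee' /IH].
Qed.

Lemma is_cnf_rcons_rcons s e n e' : is_cnf (rcons s (e, n)) -> olt e' e ->
  is_cnf (rcons (rcons s (e, n)) (e', 1%N)).
Proof.
move=> + e'e; elim: s => [|[e1 n1] s IH] /=; first by case.
by case: s IH => [|[e2 n2] s] IH [n'0 ee' /IH].
Qed.

Lemma olt_least (P : Ord -> Prop) a : P a ->
  exists b, [/\ P b, ole b a & forall c, olt c b -> ~ P c].
Proof.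
elim: (olt_wf a) => {}a _ IH Pa.
have [[c ca Pc]|nP] := pselect (exists2 c, olt c a & P c).
  have [b [Pb bc minb]] := IH c ca Pc; exists b; split=> //.
  exact: ole_trans bc (oltW _ _ ca).
exists a; split=> //; first exact: ole_refl.
by move=> c ca Pc; apply: nP; exists c.
Qed.

Lemma limit_rank_max n a : ~ limit_rank n a ->
  exists2 j, limit_rank j a & ~ limit_rank j.+1 a.
Proof.
elim: n => [/(_ I)//|n IH] nj; have [ja|/IH//] := pselect (limit_rank n a).
by exists n.
Qed.

(** With [b < a] least such that no ordinal strictly between [b] and [a] has rank [j],
    [a = b + omega ^ j]. By induction [b], if nonzero, has a normal form ending in its own rank,
    which is at least [j]. The bound [n] ensures that all these ranks are finite. *)
Lemma cnf_of_limit_rank n a j :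
  (forall m, ole m a -> ~ limit_rank n m) ->
  olt ozero a -> limit_rank j a -> ~ limit_rank j.+1 a ->
  exists s c, is_cnf (rcons s (ofin j, c)) /\
    oeq a (cnf_value (rcons s (ofin j, c))).
Proof.
elim: (olt_wf a) j => {}a _ IH j bnd a0 ja nja.
have [b0 [b0a nb0]] : exists b, olt b a /\
    forall m, olt b m -> olt m a -> ~ limit_rank j m.
  apply: contrapT => nex; apply: nja; split=> // b ba.
  apply: contrapT => nm; apply: nex; exists b; split=> // m bm ma jm.
  by apply: nm; exists m.
have [b [nb bb0 minb]] := olt_least (fun b =>
  forall m, olt b m -> olt m a -> ~ limit_rank j m) _ nb0.
have ba := ole_lt_trans _ _ _ bb0 b0a.
have aE := limit_rank_next _ _ _ ba ja nb.
have [beq0|bgt0] := oeq0Vlt b.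
  exists [::], 1%N; split=> //; apply: oeq_trans aE _.
  apply: oeq_sym; apply: oeq_trans (oadd0 _) _.
  apply: oeq_trans (omegaM1 _) _; apply: oeq_sym.
  exact: oeq_trans (oadd_eq _ _ _ _ beq0 (oeq_refl _)) (add0o _).
have bndb m : ole m b -> ~ limit_rank n m.
  by move=> mb; apply: bnd; apply: ole_trans mb _; exact: oltW.
have [j' jb njb] := limit_rank_max _ _ (bndb b (ole_refl b)).
have [s [c [cnfs bE]]] := IH b ba j' bndb bgt0 jb njb.
(* For [j > 0], if the ordinals of rank [j - 1] below [b] were bounded by some [d < b], then [b]
   would not have rank [j] and [d] could replace it, against minimality. *)
have jj' : (j <= j')%N.
  rewrite leqNgt; apply/negP => j'j; apply: njb.
  case: j j'j {nja ja IH aE nb0} nb minb => // j j'j nb minb.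
  apply: (limit_rank_le _ j.+1) => //; split=> // d db.
  apply: contrapT => nm; apply: (minb _ db) => m dm ma.
  have [mb jm|bm] := ole_total m b; last exact: nb.
  have [mE|mlt] := ole_eqVlt _ _ mb.
    have [_ /(_ _ db)[m' [dm' m'b jm']]] := limit_rank_eq _ _ _ mE jm.
    by apply: nm; exists m'.
  by apply: nm; exists m; split=> //; exact: limit_rankW.
(* Equal ranks raise the last coefficient; otherwise a new term is appended. *)
move: jj'; rewrite leq_eqVlt => /predU1P[jE|jj'].
  rewrite -jE in cnfs bE; exists s, c.+1; split; first exact: is_cnf_rconsS.
  apply: oeq_trans aE _.
  apply: oeq_trans (oeq_sym _ _ (cnf_value_rcons _ _ _)).
  apply: oeq_sym.
  apply: oeq_trans (oadd_eq _ _ _ _ (oeq_refl _) (omulS _ _ (omega_exp_gt0 _))) _.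
  apply: oeq_trans (oaddA _ _ _) (oadd_eq _ _ _ _ _ (oeq_refl _)).
  exact: oeq_sym (oeq_trans _ _ _ bE (cnf_value_rcons _ _ _)).
exists (rcons s (ofin j', c)), 1%N; split.
  by apply: is_cnf_rcons_rcons => //; exact: ofin_lt.
apply: oeq_trans aE _.
apply: oeq_trans (oeq_sym _ _ (cnf_value_rcons _ _ _)).
exact: oadd_eq bE (oeq_sym _ _ (omegaM1 _)).
Qed.

(** The left summand 1 makes the ordinal positive without changing ranks. The bound carries over
    because every ordinal from 1 to [1 + a] is [1 + y] with [y <= a]. *)
Lemma ord_is_limit_rank n a k :
  (forall m, ole m a -> ~ limit_rank n m) ->
  limit_rank k a -> ~ limit_rank k.+1 a ->
  ord_is (oadd (ofin 1) a) (ofin k).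
Proof.
move=> bnd ka nka.
have [||||s [c [cnfs E]]] := @cnf_of_limit_rank n (oadd (ofin 1) a) k.
- move=> m m1a nm.
  case: n bnd nm => [/(_ a (ole_refl a))//|n] bnd nm.
  have [mE|mlt] := ole_eqVlt _ _ m1a.
    apply: (bnd a (ole_refl a)); apply: limit_rank_succ.
    exact: limit_rank_eq mE nm.
  have [m1|[y ya mE]] := olt_addP _ _ _ mlt.
    case: nm => m0 _; case: m1 => -[] m1; exact: ole_ltF m1 m0.
  apply: (bnd y (oltW _ _ ya)); apply: limit_rank_succ.
  exact: limit_rank_eq mE nm.
- exact: olt_le_trans (oltS _) (ole_addl _ _).
- exact: succ_limit_rank.
- by move=> /limit_rank_succ.
by exists s, (ofin k), c; split=> //; exact: oeq_refl.
Qed.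

Lemma ord_is_eq a b k : oeq a b -> ord_is a k -> ord_is b k.
Proof.
move=> ab [s [e [c [cnfs aE ke]]]]; exists s, e, c; split=> //.
exact: oeq_trans (oeq_sym _ _ ab) aE.
Qed.

(** * Integer complexity *)

Lemma value_gt0 e : (0 < value e)%N.
Proof.
by elim: e => //= a IHa b IHb; rewrite ?muln_gt0 ?addn_gt0 IHa ?IHb.
Qed.

Lemma ones_gt0 e : (0 < ones e)%N.
Proof. by elim: e => //= a IHa b IHb; rewrite addn_gt0 IHa. Qed.

Lemma complexity_le e : (complexity (value e) <= ones e)%N.
Proof.
rewrite /complexity; case: pselect => //= ex.
by case: ex_minnP => m _; apply; apply/asboolP; exists e.
Qed.

Lemma complexity_expr n : (0 < n)%N ->
  exists2 e, value e = n & ones e = complexity n.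
Proof.
move=> n0; rewrite /complexity; case: pselect => /= [ex|nex].
  by case: ex_minnP => m /asboolP[e [ve oe]] _; exists e.
suff [e ve] : exists e, value e = n.
  by case: nex; exists (ones e); apply/asboolP; exists e.
case: n n0 {nex} => // n _; elim: n => [|n [e ve]]; first by exists One.
by exists (Add e One); rewrite /= ve addn1.
Qed.

Lemma complexity_gt0 n : (0 < n)%N -> (0 < complexity n)%N.
Proof. by move=> /complexity_expr[e _ <-]; exact: ones_gt0. Qed.

Lemma complexityD a b : (0 < a)%N -> (0 < b)%N ->
  (complexity (a + b) <= complexity a + complexity b)%N.
Proof.
move=> /complexity_expr[e <- <-] /complexity_expr[f <- <-].
exact: (complexity_le (Add e f)).
Qed.

Lemma complexityM a b : (0 < a)%N -> (0 < b)%N ->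
  (complexity (a * b) <= complexity a + complexity b)%N.
Proof.
move=> /complexity_expr[e <- <-] /complexity_expr[f <- <-].
exact: (complexity_le (Mul e f)).
Qed.

Lemma complexity1 : (complexity 1 <= 1)%N.
Proof. exact: (complexity_le One). Qed.

(** The exponent starts at 1 because [3 ^ 0 = 1] still costs one [One]. *)
Lemma complexity_pow3 t : (complexity (3 ^ t.+1) <= 3 * t.+1)%N.
Proof.
have c3 : (complexity 3 <= 3)%N by exact: (complexity_le (Add One (Add One One))).
elim: t => [//|t IH]; rewrite expnS.
apply: leq_trans (complexityM _ _ _ _) _ => //; first by rewrite expn_gt0.
by rewrite [(3 * t.+2)%N]mulnS leq_add.
Qed.

Lemma complexity_pow3M t n : (0 < n)%N ->
  (complexity (3 ^ t * n) <= 3 * t + complexity n)%N.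
Proof.
case: t => [|t] n0; first by rewrite mul1n.
apply: leq_trans (complexityM _ _ _ n0) _; first by rewrite expn_gt0.
by rewrite leq_add2r complexity_pow3.
Qed.

(** The classical bound [3 log_3 n <= ||n||], in integers. If [2 <= b <= a], then [a + b <= a * b]
    reduces sums to products; adding 1 to [a >= 3] at most triples the cube; [1 + 1] and [2 + 1] are
    checked by hand. *)
Lemma value_cube_le e : (value e ^ 3 <= 3 ^ ones e)%N.
Proof.
have addle : forall a b c d, (0 < a)%N -> (0 < b)%N -> (b <= a)%N ->
    (0 < c)%N -> (0 < d)%N -> (a ^ 3 <= 3 ^ c)%N -> (b ^ 3 <= 3 ^ d)%N ->
    ((a + b) ^ 3 <= 3 ^ (c + d))%N.
  move=> a b c d a0 b0 ba c0 d0 ac bd; rewrite expnD.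
  have [b2|b1] := ltnP 1 b.
    apply: leq_trans (leq_mul ac bd); rewrite -expnMn leq_exp2r //; nia.
  have {b1 b0 bd} -> : b = 1%N by lia.
  have [a3|a2] := ltnP 2 a.
    suff : ((a + 1) ^ 3 <= a ^ 3 * 3)%N.
      move/leq_trans; apply; apply: leq_mul => //.
      by rewrite -{1}(expn1 3) leq_exp2l.
    rewrite !expnS !expn0 !muln1; nia.
  have [aE|aE] : a = 1%N \/ a = 2%N by lia.
    by rewrite aE -expnD (@leq_trans (3 ^ 2)) // leq_exp2l //; lia.
  have c2 : (1 < c)%N by move: ac; rewrite aE; case: c c0 => [|[|c]].
  by rewrite aE -expnD (@leq_trans (3 ^ 3)) // leq_exp2l //; lia.
elim: e => //= a IHa b IHb.
  have [ba|ab] := leqP (value b) (value a).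
    by apply: addle => //; rewrite ?value_gt0 ?ones_gt0.
  rewrite addnC [(ones a + _)%N]addnC.
  by apply: addle => //; rewrite ?value_gt0 ?ones_gt0 // ltnW.
by rewrite expnMn expnD leq_mul.
Qed.

Lemma cube_le_complexity n : (n ^ 3 <= 3 ^ complexity n)%N.
Proof.
case: (posnP n) => [->|/complexity_expr[e <- <-]]; last exact: value_cube_le.
by rewrite exp0n.
Qed.

(** * Irreducible numbers of bounded defect *)

(* [3^delta(n) <= M] is stated as [3^||n|| <= M n^3], and [1 / K] is the
   precision up to which [n] may be shrunk. *)
Definition reducible K n := exists n',
  [/\ (0 < n')%N, (n' <= n)%N, (complexity n' < complexity n)%N
    & (K * (n - n') <= n')%N].

Lemma reducibleMl K a b : (0 < b)%N ->
  complexity (a * b) = (complexity a + complexity b)%N ->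
  reducible K a -> reducible K (a * b).
Proof.
move=> b0 ab [a' [a'0 a'a ca' Ka]]; exists (a' * b)%N; split.
- by rewrite muln_gt0 a'0.
- by rewrite leq_mul.
- apply: leq_ltn_trans (complexityM _ _ a'0 b0) _.
  by rewrite ab ltn_add2r.
- by rewrite -mulnBl mulnA leq_mul.
Qed.

Lemma reducibleDl K a b : (0 < a)%N -> (0 < b)%N ->
  complexity (a + b) = (complexity a + complexity b)%N ->
  (K * b <= a)%N -> reducible K (a + b).
Proof.
move=> a0 b0 ab Kba; exists a; split=> //.
- exact: leq_addr.
- by rewrite ab -addn1 leq_add2l complexity_gt0.
- by rewrite addKn.
Qed.

Lemma cube_eq_pow3 n c : (n ^ 3 = 3 ^ c)%N -> exists t, n = (3 ^ t)%N.
Proof.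
move=> n3; have /(dvdn_pfactor _ _) : (n %| 3 ^ c)%N.
  by rewrite -n3 expnS dvdn_mulr.
by move=> /(_ isT)[t _ ->]; exists t.
Qed.

(** Irreducibility gives [a <= K * b]. From [(a + b) ^ 3 <= 8 * a ^ 3 <= 8 * 3 ^ ||a||], the defect
    bound leaves [3 ^ ||b|| <= 8 * M], hence [b <= 8 * M]. *)
Lemma irreducible_add_bound M K a b : (0 < a)%N -> (0 < b)%N -> (b <= a)%N ->
  complexity (a + b) = (complexity a + complexity b)%N ->
  (3 ^ complexity (a + b) <= M * (a + b) ^ 3)%N ->
  ~ reducible K (a + b) -> (a + b <= K.+1 * (8 * M))%N.
Proof.
move=> a0 b0 ba ab nM nr.
have aKb : (a <= K * b)%N.
  by rewrite leqNgt; apply/negP => /ltnW /(reducibleDl _ _ _ a0 b0 ab).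
suff b8 : (b <= 8 * M)%N by rewrite mulSn addnC leq_add // (leq_trans aKb) // leq_mul.
apply: (@leq_trans (b ^ 3)).
  by rewrite -{1}(expn1 b) leq_pexp2l.
apply: leq_trans (cube_le_complexity b) _.
have p0 : (0 < 3 ^ complexity a)%N by rewrite expn_gt0.
rewrite -(leq_pmul2l p0) -expnD -ab; apply: leq_trans nM _.
have -> : (3 ^ complexity a * (8 * M) = M * (8 * 3 ^ complexity a))%N by ring.
rewrite leq_mul2l; apply/orP; right.
apply: (@leq_trans (8 * a ^ 3)); last by rewrite leq_mul2l cube_le_complexity.
by rewrite -[8%N]/(2 ^ 3)%N -expnMn leq_exp2r // mul2n -addnn leq_add2l.
Qed.

(* [i] counts the factors that are not powers of 3; each of them multiplies
   3^delta by at least [1 + 1 / B^3]. *)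
Lemma irreducible_factors M K n : (0 < n)%N ->
  (3 ^ complexity n <= M * n ^ 3)%N -> ~ reducible K n ->
  let B := (K.+1 * (8 * M))%N in
  exists t m i, [/\ n = (3 ^ t * m)%N, (m <= B ^ i)%N &
    ((B ^ 3).+1 ^ i * n ^ 3 <= 3 ^ complexity n * (B ^ 3) ^ i)%N].
Proof.
move=> n0 nM nr B; have [e ve oe] := complexity_expr n n0.
elim: e n n0 nM nr ve oe => [|e1 _ e2 _|e1 IH1 e2 IH2] n n0 nM nr /= ve oe.
- exists 0%N, 1%N, 0%N; rewrite -ve !expn0 !mul1n muln1; split=> //.
  by rewrite expn_gt0.
- have cD : complexity n = (complexity (value e1) + complexity (value e2))%N.
    apply/eqP; rewrite eqn_leq -{1}ve complexityD ?value_gt0 //=.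
    by rewrite -oe leq_add ?complexity_le.
  have nB : (n <= B)%N.
    rewrite -ve in cD nM nr *.
    have [ba|/ltnW ab] := leqP (value e2) (value e1).
      by apply: irreducible_add_bound; rewrite ?value_gt0.
    rewrite addnC [X in _ = X]addnC in cD; rewrite addnC in nM nr *.
    by apply: irreducible_add_bound; rewrite ?value_gt0.
  (* A sum of defect 0 is a power of 3 and is not counted. Otherwise [3 ^ ||n|| >= n ^ 3 + 1], and
     [n <= B] turns this into the gain [1 + 1 / B ^ 3]. *)
  have [/cube_eq_pow3[t nE]|n3] := eqVneq (n ^ 3)%N (3 ^ complexity n)%N.
    exists t, 1%N, 0%N; rewrite !expn0 !mul1n !muln1; split=> //.
    exact: cube_le_complexity.
  exists 0%N, n, 1%N; rewrite expn0 mul1n !expn1; split=> //.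
  have n3lt : (n ^ 3 < 3 ^ complexity n)%N by rewrite ltn_neqAle n3 cube_le_complexity.
  rewrite mulSn addnC [leqRHS]mulnC.
  apply: leq_trans (leq_mul (leqnn (B ^ 3)) n3lt).
  by rewrite [leqRHS]mulnS addnC leq_add2r leq_exp2r.
- have [c1 c2] : ones e1 = complexity (value e1) /\ ones e2 = complexity (value e2).
    have := complexityM _ _ (value_gt0 e1) (value_gt0 e2).
    rewrite ve -oe; have := complexity_le e1; have := complexity_le e2; lia.
  have cM : complexity n = (complexity (value e1) + complexity (value e2))%N.
    by rewrite -oe c1 c2.
  rewrite -ve in cM nM nr *.
  have nr1 : ~ reducible K (value e1).
    by move=> r1; apply: nr; apply: reducibleMl; rewrite ?value_gt0.
  have nr2 : ~ reducible K (value e2).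
    move=> r2; apply: nr; rewrite mulnC; apply: reducibleMl; rewrite ?value_gt0 //.
    by rewrite mulnC cM addnC.
  (* The cofactor has nonnegative defect, so the bound [M] passes to each factor. *)
  have factM e f : (3 ^ (complexity (value e) + complexity (value f)) <=
      M * (value e * value f) ^ 3)%N ->
      (3 ^ complexity (value e) <= M * value e ^ 3)%N.
    have p0 : (0 < value f ^ 3)%N by rewrite expn_gt0 value_gt0.
    rewrite expnMn mulnA => efM; rewrite -(leq_pmul2r p0).
    apply: leq_trans efM.
    by rewrite expnD leq_mul2l cube_le_complexity orbT.
  rewrite cM in nM.
  have [t1 [m1 [i1 [E1 mB1 d1]]]] :=
    IH1 _ (value_gt0 e1) (factM _ _ nM) nr1 erefl c1.
  have [t2 [m2 [i2 [E2 mB2 d2]]]] : exists t m i, [/\ value e2 = (3 ^ t * m)%N,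
      (m <= B ^ i)%N & ((B ^ 3).+1 ^ i * value e2 ^ 3 <=
        3 ^ complexity (value e2) * (B ^ 3) ^ i)%N].
    apply: IH2 => //; first exact: value_gt0.
    by apply: (factM _ e1); rewrite addnC [(value e2 * _)%N]mulnC.
  exists (t1 + t2)%N, (m1 * m2)%N, (i1 + i2)%N; split.
  + by rewrite E1 E2 expnD mulnACA.
  + by rewrite expnD leq_mul.
  + rewrite cM !expnD expnMn.
    have := leq_mul d1 d2; congr (_ <= _)%N; ring.
Qed.

(** This is [1 + i / B <= (1 + 1 / B) ^ i] with denominators cleared. *)
Lemma bernoulli B i : (B ^ i * (B + i) <= B.+1 ^ i * B)%N.
Proof.
elim: i => [|i IH]; first by rewrite !expn0 addn0.
rewrite [in leqRHS]expnS -mulnA; apply: leq_trans (leq_mul (leqnn B.+1) IH).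
rewrite expnSr -mulnA; set p := (B ^ i)%N.
by rewrite [leqRHS]mulnCA leq_mul2l; apply/orP; right; nia.
Qed.

(** With [C = B ^ 3], the counted factors give [(1 + 1 / C) ^ i <= M], so [i <= M * C] by Bernoulli,
    and [m <= B ^ i] is bounded. *)
Lemma irreducible_finite M K : exists N, forall n, (0 < n)%N ->
  (3 ^ complexity n <= M * n ^ 3)%N -> ~ reducible K n ->
  exists t m, n = (3 ^ t * m)%N /\ (m <= N)%N.
Proof.
set B := (K.+1 * (8 * M))%N; exists (B.+1 ^ (M * B ^ 3))%N => n n0 nM nr.
have [t [m [i [nE mB di]]]] := irreducible_factors M K n n0 nM nr.
exists t, m; split=> //; apply: leq_trans mB _; rewrite -/B in di *.
have M0 : (0 < M)%N.
  by case: (M) nM => //; rewrite mul0n leqn0 expn_eq0.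
have B0 : (0 < B)%N by rewrite !muln_gt0 M0.
suff iM : (i <= M * B ^ 3)%N.
  apply: (@leq_trans (B ^ (M * B ^ 3))); first by rewrite leq_pexp2l.
  by rewrite leq_exp2r // muln_gt0 M0 expn_gt0 B0.
have n30 : (0 < n ^ 3)%N by rewrite expn_gt0 n0.
have C0 : (0 < B ^ 3)%N by rewrite expn_gt0 B0.
have := bernoulli (B ^ 3) i; move: (B ^ 3)%N C0 di => C C0 di be.
have iC : (C.+1 ^ i <= M * C ^ i)%N.
  rewrite -(leq_pmul2r n30); apply: leq_trans di _.
  rewrite [leqRHS]mulnAC; exact: leq_mul.
have Ci0 : (0 < C ^ i)%N by rewrite expn_gt0 C0.
have : (C ^ i * (C + i) <= C ^ i * (M * C))%N.
  apply: leq_trans be _; rewrite mulnA [(C ^ i * M)%N]mulnC.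
  exact: leq_mul.
by rewrite leq_pmul2l //; apply: leq_trans; exact: leq_addl.
Qed.

(** Any [l] minimising [||3 ^ l * n|| - 3 * l] works; [lb] shows that the truncated subtraction is
    exact. *)
Lemma exists_stable n : (0 < n)%N -> exists l, stable (3 ^ l * n)%N.
Proof.
move=> n0; have p0 l : (0 < 3 ^ l * n)%N by rewrite muln_gt0 expn_gt0.
have lb l : (3 * l <= complexity (3 ^ l * n))%N.
  rewrite -(@leq_exp2l 3) //; apply: leq_trans (cube_le_complexity _).
  rewrite expnMn -expnM [(l * 3)%N]mulnC.
  by rewrite leq_pmulr // expn_gt0 n0.
have [l _ lmin] : exists2 l, True & forall k,
    (complexity (3 ^ l * n) - 3 * l <= complexity (3 ^ k * n) - 3 * k)%N.
  have ex : exists c, `[< exists l, c = (complexity (3 ^ l * n) - 3 * l)%N >].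
    by exists (complexity (3 ^ 0 * n) - 3 * 0)%N; apply/asboolP; exists 0%N.
  case: (ex_minnP ex) => c /asboolP[l ->] cmin; exists l => // k.
  by apply: cmin; apply/asboolP; exists k.
exists l; split=> // k; apply/eqP; rewrite eqn_leq complexity_pow3M //=.
have := lmin (k + l)%N; rewrite expnD -mulnA.
have := lb l; have := lb (k + l)%N; rewrite expnD -mulnA; lia.
Qed.

(** 1 is not stable, since [||3|| <= 3 < 3 + ||1||]. *)
Lemma stable_gt1 q : stable q -> (1 < q)%N.
Proof.
case: q => [|[|q]] // [] // _ /(_ 1%N).
have c3 : (complexity (3 ^ 1 * 1) <= 3)%N by exact: (complexity_pow3 0).
have := complexity_gt0 1 isT; lia.
Qed.

Lemma stable_pow3 m t : stable m ->
  complexity (3 ^ t * m) = (3 * t + complexity m)%N.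
Proof. by case=> _; apply. Qed.

(** The hypothesis encodes [delta(m) + B = delta(m') + A]. Comparing 3-adic valuations, the two
    exponents of 3 differ by a multiple [3 * t], so [m = 3 ^ t * m'], and stability of [m']
    determines [||m||]. *)
Lemma stable_cube_inj m m' A B : stable m -> stable m' ->
  (m ^ 3 * 3 ^ (complexity m' + A) = m' ^ 3 * 3 ^ (complexity m + B))%N -> A = B.
Proof.
wlog le : m m' A B / (complexity m' + A <= complexity m + B)%N.
  move=> wl sm sm' E; have [/wl|/ltnW/wl wl'] :=
    leqP (complexity m' + A) (complexity m + B); first exact.
  exact/esym/wl'.
move=> sm sm' E.
have m0 : (0 < m)%N by case: sm.
have m'0 : (0 < m')%N by case: sm'.
have lE : (logn 3 m * 3 + (complexity m' + A) =
    logn 3 m' * 3 + (complexity m + B))%N.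
  have := congr1 (logn 3) E.
  rewrite !lognM ?expn_gt0 ?muln_gt0 ?m0 ?m'0 // !lognX.
  have -> : logn 3 3 = 1%N by [].
  lia.
set t := (logn 3 m - logn 3 m')%N.
have tE : (complexity m + B = complexity m' + A + 3 * t)%N by rewrite /t; lia.
have mE : m = (3 ^ t * m')%N.
  apply/eqP; rewrite -(eqn_exp2r _ _ (isT : 0 < 3)%N) expnMn -expnM.
  have p0 : (0 < 3 ^ (complexity m' + A))%N by rewrite expn_gt0.
  rewrite -(eqn_pmul2r p0) E tE [in X in X == _]expnD; apply/eqP.
  by rewrite [(t * 3)%N]mulnC; ring.
by move: tE; rewrite mE stable_pow3 //; lia.
Qed.

(** * Defects *)

Section RealPart.
Variable R : realType.
Implicit Types (x y e : R) (A S : set R).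

Lemma closure_normP A x :
  closure A x <-> forall e, 0 < e -> exists2 y, A y & `|x - y| < e.
Proof.
split=> [Ax e e0|Ax B /nbhs_ballP[e /= e0 eB]].
  have [y [Ay xy]] := Ax _ (nbhsx_ballx x e e0); exists y => //.
by have [y Ay xy] := Ax e e0; exists y; split=> //; exact: eB.
Qed.

(** Makes the integer [c] independent of [e]: if every [c <= B] failed at some threshold, all would
    fail at the least of these finitely many thresholds. *)
Lemma pigeonhole_small (P : nat -> R -> Prop) (B : nat) :
  (forall c e e', e <= e' -> P c e -> P c e') ->
  (forall e, 0 < e -> exists2 c, (c <= B)%N & P c e) ->
  exists c, forall e, 0 < e -> P c e.
Proof.
move=> mono PB; apply: contrapT => nP.
have nPc c : exists2 e, 0 < e & ~ P c e.
  apply: contrapT => nPc; apply: nP; exists c => e e0.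
  by apply: contrapT => nPce; apply: nPc; exists e.
have [e e0 ne] : exists2 e, 0 < e & forall c, (c <= B)%N -> ~ P c e.
  elim: B {PB} => [|B [e1 e10 ne1]].
    by have [e e0 ne] := nPc 0%N; exists e => // c; rewrite leqn0 => /eqP ->.
  have [e2 e20 ne2] := nPc B.+1.
  exists (Num.min e1 e2); first by rewrite lt_min e10.
  move=> c; rewrite leq_eqVlt => /predU1P[->|/ne1 nc] Pc.
    by apply: ne2; apply: mono Pc; rewrite ge_min lexx orbT.
  by apply: nc; apply: mono Pc; rewrite ge_min lexx.
by have [c cB] := PB e e0; exact: ne.
Qed.

Lemma seq_gap (s : seq R) x :
  exists2 e, 0 < e & forall v, v \in s -> v != x -> e <= `|x - v|.
Proof.
elim: s => [|v s [e e0 es]]; first by exists 1.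
have [->|vx] := eqVneq v x.
  by exists e => // w; rewrite inE => /predU1P[->|/es//]; rewrite eqxx.
exists (Num.min e `|x - v|).
  by rewrite lt_min e0 normr_gt0 subr_eq0 eq_sym.
move=> w; rewrite inE => /predU1P[-> _|ws wx]; first by rewrite ge_min lexx orbT.
by rewrite ge_min es.
Qed.

Lemma natr_bound x : exists n : nat, x < n%:R.
Proof.
exists (Num.bound `|x|); apply: le_lt_trans (ler_norm x) _.
exact: archi_boundP.
Qed.

(** * Logarithms and defects *)

Let cubelog (n : nat) : R := 3 * (ln n%:R / ln 3).

Lemma ln3_gt0 : 0 < ln 3 :> R.
Proof. by rewrite ln_gt0 // ltr1n. Qed.

Lemma defectE n : defect R n = (complexity n)%:R - cubelog n.
Proof. by []. Qed.

Lemma cubelog_ln n a : (0 < n)%N ->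
  ln ((n ^ 3 * 3 ^ a)%:R : R) = ln 3 * (cubelog n + a%:R).
Proof.
move=> n0; have nR0 : 0 < n%:R :> R by rewrite ltr0n.
rewrite natrM !natrX lnM ?posrE ?exprn_gt0 ?ltr0n // !lnXn ?ltr0n //.
rewrite /cubelog -[_ *+ 3]mulr_natl -[_ *+ a]mulr_natl.
by have := ln3_gt0; set l := ln 3; move=> l0; field; rewrite gt_eqF.
Qed.

(** The bridge between real inequalities on defects and the integer inequalities above. *)
Lemma cubelog_le m n a b : (0 < m)%N -> (0 < n)%N ->
  (cubelog m + a%:R <= cubelog n + b%:R) = (m ^ 3 * 3 ^ a <= n ^ 3 * 3 ^ b)%N.
Proof.
move=> m0 n0; rewrite -(ler_pM2l ln3_gt0) -!cubelog_ln // ler_ln ?ler_nat //.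
  by rewrite posrE ltr0n muln_gt0 !expn_gt0 m0.
by rewrite posrE ltr0n muln_gt0 !expn_gt0 n0.
Qed.

Lemma cubelog1 : cubelog 1 = 0.
Proof. by rewrite /cubelog ln1 mul0r mulr0. Qed.

Lemma cubelog_pow3M t n : (0 < n)%N -> cubelog (3 ^ t * n) = (3 * t)%:R + cubelog n.
Proof.
move=> n0; have p0 : (0 < 3 ^ t * n)%N by rewrite muln_gt0 expn_gt0.
have E : ((3 ^ t * n) ^ 3 * 3 ^ 0 = n ^ 3 * 3 ^ (3 * t))%N.
  by rewrite expnMn -expnM muln1 mulnC [(t * 3)%N]mulnC.
have EQ : cubelog (3 ^ t * n) + 0%:R = cubelog n + (3 * t)%:R.
  by apply/eqP; rewrite eq_le !cubelog_le // E leqnn.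
by move: EQ; rewrite mulr0n addr0 addrC.
Qed.

Lemma cubelog_mono m n : (0 < m)%N -> (0 < n)%N ->
  (cubelog m <= cubelog n) = (m <= n)%N.
Proof.
move=> m0 n0; have := cubelog_le m n 0 0 m0 n0.
by rewrite mulr0n !addr0 !muln1 leq_exp2r.
Qed.

Lemma cubelog_ge0 n : 0 <= cubelog n.
Proof.
case: n => [|n]; first by rewrite /cubelog ln0 // mul0r mulr0.
by rewrite mulr_ge0 // divr_ge0 ?ln_ge0 ?ler1n // ltW // ln3_gt0.
Qed.

Lemma defect_ge0 n : (0 < n)%N -> 0 <= defect R n.
Proof.
move=> n0; rewrite defectE subr_ge0.
have := cubelog_le n 1 0 (complexity n) n0 isT.
by rewrite cubelog1 add0r mulr0n addr0 muln1 mul1n cube_le_complexity.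
Qed.

Lemma defect_pow3M t n : (0 < n)%N ->
  defect R (3 ^ t * n) = (complexity (3 ^ t * n))%:R - (3 * t)%:R - cubelog n.
Proof. by move=> n0; rewrite defectE cubelog_pow3M // opprD addrA. Qed.

Lemma defect_le_bound r : exists M, forall n, (0 < n)%N -> defect R n <= r ->
  (3 ^ complexity n <= M * n ^ 3)%N.
Proof.
have [a ra] := natr_bound r; exists (3 ^ a)%N => n n0 nr.
have := cubelog_le 1 n (complexity n) a isT n0.
rewrite cubelog1 add0r mul1n mulnC => <-.
by move: nr ra; rewrite defectE; lra.
Qed.

(** Apply [ln (1 + x) <= x] at [x = (n - m) / m <= 1 / K]. *)
Lemma cubelog_near K n m : (0 < K)%N -> (0 < m)%N -> (m <= n)%N ->
  (K * (n - m) <= m)%N -> cubelog n - cubelog m <= 3 / ln 3 / K%:R.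
Proof.
move=> K0 m0 mn Knm.
have mR0 : 0 < m%:R :> R by rewrite ltr0n.
have KR0 : 0 < K%:R :> R by rewrite ltr0n.
have nR0 : 0 < n%:R :> R by rewrite ltr0n (leq_trans m0).
have -> : cubelog n - cubelog m = 3 / ln 3 * (ln n%:R - ln m%:R).
  by rewrite /cubelog; ring.
rewrite ler_pM2l ?divr_gt0 ?ln3_gt0 // -ln_div ?posrE //.
have -> : n%:R / m%:R = 1 + (n%:R - m%:R) / m%:R :> R.
  by field; rewrite gt_eqF.
apply: le_trans (le_ln1Dx _) _.
  by apply: (@lt_le_trans _ _ 0); rewrite ?ltrN10 // divr_ge0 ?subr_ge0 ?ler_nat.
rewrite ler_pdivrMr // mulrC ler_pdivlMr // -natrB // -natrM ler_nat.
by rewrite mulnC.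
Qed.

Lemma small_inverse e : 0 < e -> exists2 K, (0 < K)%N &
  forall K', (K <= K')%N -> 3 / ln 3 / K'%:R < e.
Proof.
move=> e0; have [K KP] := natr_bound (3 / ln 3 / e).
have c0 : 0 < 3 / ln 3 :> R by rewrite divr_gt0 // ln3_gt0.
have K0 : 0 < K%:R :> R by apply: lt_trans KP; rewrite divr_gt0.
exists K => [|K' KK']; first by rewrite -(ltr0n R).
have K'K : K%:R <= K'%:R :> R by rewrite ler_nat.
rewrite ltr_pdivrMr ?(lt_le_trans K0) // -ltr_pdivrMl // mulrC.
exact: lt_le_trans K'K.
Qed.

Lemma defectD_inj m m' i j : stable m -> stable m' ->
  defect R m + i%:R = defect R m' + j%:R -> i = j.
Proof.
move=> sm sm' E; apply/esym; apply: (stable_cube_inj m m') => //.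
have m0 : (0 < m)%N by case: sm.
have m'0 : (0 < m')%N by case: sm'.
have {}E : cubelog m + (complexity m' + j)%:R = cubelog m' + (complexity m + i)%:R.
  by move: E; rewrite !defectE !natrD; lra.
by apply/eqP; rewrite eqn_leq -!cubelog_le // E lexx.
Qed.

(** * Limits of stable defects and ranks in the closure *)

Definition limit_of_defects x := forall e, 0 < e ->
  exists2 n, stable n & 0 < `|x - defect R n| < e.

(* For [defect n] close to but different from [x], [n] is reducible, since the
   irreducible [n] contribute finitely many defects; shrinking [n] slightly
   then lowers its defect by almost exactly a positive integer. *)
Lemma limit_of_defects_sub x : limit_of_defects x ->
  exists2 c, (0 < c)%N & closure (Dst R) (x - c%:R).
Proof.
move=> limx; have [B xB] := natr_bound (x + 1).
pose P (c : nat) e :=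
  (0 < c)%N /\ exists2 n, stable n & `|x - c%:R - defect R n| < e.
suff [c cP] : exists c, forall e, 0 < e -> P c e.
  exists c; first by case: (cP 1 ltr01).
  apply/closure_normP => e /cP[_ [n sn ne]].
  by exists (defect R n) => //; exists n.
apply: (pigeonhole_small P B) => [c e e' ee' [c0 [n sn ne]]|e0 e00].
  by split=> //; exists n => //; exact: lt_le_trans ee'.
pose e := Num.min e0 1.
have e_gt0 : 0 < e by rewrite lt_min e00 ltr01.
have ee0 : e <= e0 by rewrite ge_min lexx.
have e1 : e <= 1 by rewrite ge_min lexx orbT.
suff [c c0 [n sn ne]] : exists2 c, (0 < c)%N &
    exists2 n, stable n & `|x - c%:R - defect R n| < e.
  exists c; last by split=> //; exists n => //; exact: lt_le_trans ee0.
  have n0 : (0 < n)%N by case: sn.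
  have dn := defect_ge0 n n0.
  rewrite -(ler_nat R); move: ne; rewrite ltr_norml => /andP[ne _].
  by apply: ltW; move: ne xB e1 dn; lra.
have e20 : 0 < e / 2 by rewrite divr_gt0.
have [K K0 KP] := small_inverse _ e20.
have [M MP] := defect_le_bound (x + 1).
have [N NP] := irreducible_finite M K.
(* An irreducible [n = 3 ^ t * m] of defect at most [x + 1] has defect [C - cubelog m] with
   [C <= C0] and [m <= N]. Within [g] of [x], none of these finitely many values occurs except
   possibly [x] itself. *)
have [C0 C0P] := natr_bound (x + 1 + cubelog N).
have [g g0 gP] := seq_gap
  [seq C%:R - cubelog m | C <- iota 0 C0.+1, m <- iota 0 N.+1] x.
have [n sn /andP[xn0 xn]] := limx (Num.min g (e / 2)) ltac:(by rewrite lt_min g0).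
move: xn; rewrite lt_min => /andP[xng xne].
have n0 : (0 < n)%N by case: sn.
have nx1 : defect R n <= x + 1.
  by move: xne; rewrite ltr_norml => /andP[? _]; lra.
have [[n' [n'0 n'n cn' Kn']]|nr] := pselect (reducible K n); last first.
  have [t [m [nE mN]]] := NP n n0 (MP n n0 nx1) nr.
  have m0 : (0 < m)%N by move: n0; rewrite nE muln_gt0 => /andP[].
  have lm := cubelog_ge0 m.
  have lmN : cubelog m <= cubelog N.
    by rewrite cubelog_mono // (leq_trans m0 mN).
  have := defect_ge0 n n0.
  have dE : defect R n = (complexity n)%:R - (3 * t)%:R - cubelog m.
    by rewrite {1}nE defect_pow3M // -nE.
  rewrite dE => d0.
  have ct : (3 * t <= complexity n)%N by rewrite -(ler_nat R); lra.
  have := gP (defect R n); rewrite leNgt xng dE -natrB //.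
  have -> : (complexity n - 3 * t)%:R - cubelog m \in
    [seq C%:R - cubelog m | C <- iota 0 C0.+1, m <- iota 0 N.+1].
    apply: (allpairs_f (fun C m => C%:R - cubelog m)); rewrite mem_iota /= add0n ltnS //.
    rewrite -(ler_nat R) natrB //; move: nx1; rewrite dE; lra.
  move=> /(_ isT); rewrite natrB // -dE => h; suff : false by [].
  by apply: h; rewrite eq_sym -subr_eq0 -normr_gt0.
have [l sl] := exists_stable n' n'0.
have cl := complexity_pow3M l n' n'0.
set c'' := complexity (3 ^ l * n') in cl.
have cE : (complexity n + 3 * l - c'' + c'' = complexity n + 3 * l)%N.
  by rewrite subnK //; clear -cl cn'; lia.
(* This drop is positive because [c'' <= 3 * l + ||n'|| < 3 * l + ||n||]. The new defect is
   [defect n] minus the drop, plus [cubelog n - cubelog n'], which is below [e / 2]. *)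
exists (complexity n + 3 * l - c'')%N; first by clear -cl cn'; lia.
exists (3 ^ l * n')%N => //.
have near := cubelog_near _ _ _ K0 n'0 n'n Kn'.
have small := KP K (leqnn K).
have mono : cubelog n' <= cubelog n by rewrite cubelog_mono.
have {}cE : (complexity n + 3 * l - c'')%:R + c''%:R =
    (complexity n)%:R + (3 * l)%:R :> R by rewrite -!natrD cE.
rewrite defect_pow3M // -/c''.
move: xne; rewrite defectE !ltr_norml => /andP[xn1 xn2].
set k1 := (_ - c'')%:R in cE *; set k2 := (3 * l)%:R in cE *.
move: near small mono cE xn1 xn2; set u := _ / K%:R => *.
by apply/andP; split; lra.
Qed.

Lemma closure_Dst_ge0 x : closure (Dst R) x -> 0 <= x.
Proof.
move=> /closure_normP cx; rewrite leNgt; apply/negP => x0.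
have [|_ [n [[n0 _] ->]]] := cx (- x); first by rewrite oppr_gt0.
by have := defect_ge0 n n0; rewrite ltr_norml => ? /andP[]; lra.
Qed.

(** Induction on an integer bound for [x]: a point that is not itself a stable defect is a limit of
    them, and lowering it by some [c > 0] stays in the closure. *)
Lemma closure_Dst_defect x : closure (Dst R) x ->
  exists m j, stable m /\ x = defect R m + j%:R.
Proof.
have [N] := natr_bound x; elim: N x => [|N IH] x xN cx.
  by have := closure_Dst_ge0 _ cx; lra.
have [[n [sn ->]]|nx] := pselect (Dst R x).
  by exists n, 0%N; rewrite addr0.
have [|c c0 /IH[|m [j [sm E]]]] := limit_of_defects_sub x.
- move=> e e0; have [_ [n [sn ->]] xn] := (closure_normP _ _).1 cx e e0.
  exists n => //; rewrite xn andbT normr_gt0 subr_eq0.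
  by apply/eqP => xE; apply: nx; exists n.
- have : 1 <= c%:R :> R by rewrite ler1n.
  by move: xN; rewrite -addn1 natrD; lra.
exists m, (j + c)%N; split=> //; rewrite natrD; lra.
Qed.

(** The counterpart of [limit_rank] for points of [S]. Approach from the left is the only kind that
    a position in a well-order sees. *)
Fixpoint left_rank S j x : Prop :=
  if j is j'.+1 then
    S x /\ forall e, 0 < e -> exists2 y, left_rank S j' y & x - e < y < x
  else S x.

Lemma left_rank_mem S j x : left_rank S j x -> S x.
Proof. by case: j => // j []. Qed.

Lemma left_rankS S S' j x : S `<=` S' -> left_rank S j x -> left_rank S' j x.
Proof.
move=> SS'; elim: j x => [|j IH] x; first exact: SS'.
case=> /SS' S'x lim; split=> // e /lim[y /IH ? ?]; by exists y.
Qed.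

(** Points [defect m + i] with [i >= j] accumulate at [x] from below. Their [i] is bounded, so one
    value recurs arbitrarily close to [x]; then [x - i] is a limit of stable defects, and
    [limit_of_defects_sub] contributes a further positive integer. *)
Lemma left_rank_defect j x : left_rank (closure (Dst R)) j x ->
  exists m i, [/\ stable m, (j <= i)%N & x = defect R m + i%:R].
Proof.
elim: j x => [|j IH] x; first by move=> /closure_Dst_defect[m [i []]]; exists m, i.
case=> cx lim; have [B xB] := natr_bound x.
pose P i e := (j <= i)%N /\ exists2 m, stable m & x - e < defect R m + i%:R < x.
have [|e e0|i iP] := pigeonhole_small P B.
- move=> i e e' ee' [ji [m sm /andP[xm mx]]]; split=> //; exists m => //.
  by rewrite mx andbT; lra.
- have [y /IH[m [i [sm ji ->]]] xy] := lim e e0.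
  exists i; last by split=> //; exists m.
  rewrite -(ler_nat R); case: sm => m0 _; have := defect_ge0 m m0.
  by move: xy => /andP[]; lra.
have [|c c0] := limit_of_defects_sub (x - i%:R).
  move=> e /iP[ji [m sm /andP[xm mx]]]; exists m => //.
  have d0 : 0 < x - i%:R - defect R m by lra.
  by rewrite (gtr0_norm d0) d0 /=; lra.
move=> /closure_Dst_defect[m [i' [sm E]]]; exists m, (i' + c + i)%N; split=> //.
  by have [ji _] := iP 1 ltr01; lia.
by rewrite !natrD; lra.
Qed.

(* Otherwise the numbers [3 ^ t * q + 1] would accumulate a defect at
   [defect q + 1 - s] with [0 < s], which is not a defect plus an integer. *)
Lemma defect_succ_limit q e : stable q -> 0 < e -> exists n,
  [/\ stable n, complexity n = (complexity q).+1 %[mod 3] &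
      defect R q + 1 - e < defect R n < defect R q + 1].
Proof.
move=> sq e0; apply: contrapT => nex.
have q0 : (0 < q)%N by case: sq.
have [B qB] := natr_bound (defect R q + 1).
pose P (s : nat) e := (0 < s)%N /\ exists2 n, stable n &
  0 < `|defect R q + 1 - s%:R - defect R n| < e.
have [|e' e'0|s sP] := pigeonhole_small P B.
- move=> s e1 e2 e12 [s0 [n sn /andP[n0 ne]]]; split=> //; exists n => //.
  by rewrite n0 (lt_le_trans ne).
- have [|K K0 KP] := small_inverse (Num.min e e'); first by rewrite lt_min e0.
  (* [K] is both exponent and precision: [K <= a] makes [cubelog (a + 1) - cubelog a] small. *)
  set a := (3 ^ K * q)%N.
  have a0 : (0 < a)%N by rewrite muln_gt0 expn_gt0.
  have Ka : (K <= a)%N.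
    by apply: leq_trans (ltnW (ltn_expl K (isT : 1 < 3)%N)) _; rewrite leq_pmulr.
  have a10 : (0 < a + 1)%N by rewrite addn1.
  have near : cubelog (a + 1) - cubelog a < Num.min e e'.
    apply: le_lt_trans (KP a Ka); apply: cubelog_near => //.
      exact: leq_addr.
    by rewrite addKn muln1.
  have pos : cubelog a < cubelog (a + 1).
    by rewrite ltNge cubelog_mono // -ltnNge addn1.
  have [l sl] := exists_stable _ a10.
  have cl := complexity_pow3M l _ a10.
  have ca : (complexity (a + 1) <= 3 * K + complexity q + 1)%N.
    apply: leq_trans (complexityD a 1 a0 isT) _.
    by rewrite leq_add ?complexity1 ?complexity_pow3M.
  set c := complexity (3 ^ l * (a + 1)) in cl.
  (* [s] is the saving over the expected complexity. If [s = 0], the stable number is the one [nex]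
     excludes. *)
  have [s sE] : exists s, (s + c = 3 * l + 3 * K + complexity q + 1)%N.
    by exists (3 * l + 3 * K + complexity q + 1 - c)%N; clear -cl ca; lia.
  have dE : defect R (3 ^ l * (a + 1)) =
      defect R q + 1 - s%:R - (cubelog (a + 1) - cubelog a).
    have : s%:R + c%:R = (3 * l)%:R + (3 * K)%:R + (complexity q)%:R + 1 :> R.
      by rewrite -!natrD sE natrD.
    rewrite defect_pow3M // -/c /a (cubelog_pow3M _ _ q0) (defectE q); lra.
  have [s0|s0] := posnP s.
    case: nex; exists (3 ^ l * (a + 1))%N; split=> //.
      by rewrite -/c; move: sE; rewrite s0; lia.
    move: near; rewrite lt_min dE s0 => /andP[near _]; lra.
  exists s.
    have n0 : (0 < 3 ^ l * (a + 1))%N by case: sl.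
    by have := defect_ge0 _ n0; rewrite -(ler_nat R) dE; lra.
  split=> //; exists (3 ^ l * (a + 1))%N => //.
  rewrite dE [X in `|X|](_ : _ = cubelog (a + 1) - cubelog a); last by ring.
  rewrite gtr0_norm ?subr_gt0 // pos /=.
  by move: near; rewrite lt_min => /andP[].
(* Now [defect q + 1 = defect m + (i + s + c)] with [s] and [c] positive, while uniqueness of the
   integer part forces [i + s + c = 1]. *)
have [|c c0] := limit_of_defects_sub (defect R q + 1 - s%:R).
  by move=> e' /sP[].
move=> /closure_Dst_defect[m [i [sm E]]].
have [s0 _] := sP 1 ltr01.
have : 1%N = (i + s + c)%N.
  by apply: (defectD_inj _ _ _ _ sq sm); rewrite !natrD; lra.
lia.
Qed.

(** Induction on [k] for all [q]: the numbers [n] from [defect_succ_limit] have complexity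
    [||q|| + 1] mod 3, so the points [defect n + k] have rank [k] in the same class and approach
    [defect q + k.+1] from the left. *)
Lemma left_rank_defectD k q u : stable q -> (complexity q + k = u %[mod 3])%N ->
  left_rank (closure (Dst_mod R u)) k (defect R q + k%:R).
Proof.
elim: k q => [|k IH] q sq qu.
  apply: subset_closure; exists q; rewrite addr0; split=> //.
    exact: stable_gt1.
  by rewrite -qu addn0.
have lim e : 0 < e -> exists2 y, left_rank (closure (Dst_mod R u)) k y &
    defect R q + k.+1%:R - e < y < defect R q + k.+1%:R.
  move=> e0; have [n [sn nq /andP[n1 n2]]] := defect_succ_limit _ _ sq e0.
  exists (defect R n + k%:R); last first.
    by rewrite -addn1 natrD; apply/andP; split; lra.
  by apply: IH => //; rewrite -qu -addSnnS -modnDml nq modnDml.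
split=> //; apply/closure_normP => e e0.
have e20 : 0 < e / 2 by rewrite divr_gt0.
have [y /left_rank_mem/closure_normP /(_ _ e20)[z uz yz] /andP[y1 y2]] := lim _ e20.
exists z => //; move: yz; rewrite !ltr_norml => /andP[? ?].
by apply/andP; split; lra.
Qed.

(** * Positions in a closed set and their limit rank *)

Definition order_iso (f : R -> Ord) A (gamma : Ord) : Prop :=
  (forall x y, A x -> A y -> (x < y <-> olt (f x) (f y))) /\
  (forall b, olt b gamma <-> exists2 x, A x & oeq (f x) b).

Lemma order_iso_lt f A gamma x : order_iso f A gamma -> A x -> olt (f x) gamma.
Proof. by case=> _ fP Ax; apply/fP; exists x => //; exact: oeq_refl. Qed.

(** The same [f] serves every initial segment, which is why [order_iso] names the isomorphism hidden
    in [has_order_type]. *)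
Lemma order_iso_below f S gamma x y :
  order_iso f (S `&` [set z | z < x]) gamma -> S y -> y < x ->
  order_iso f (S `&` [set z | z < y]) (f y).
Proof.
move=> fiso Sy yx; have [fmono fP] := fiso; split.
  move=> z w [Sz zy] [Sw wy].
  by apply: fmono; split=> //=; [exact: lt_trans zy yx | exact: lt_trans wy yx].
move=> b; split=> [bfy|[z [Sz /= zy] zb]].
  have [|z [Sz /= zx] zb] := (fP b).1.
    by apply: olt_trans bfy _; exact: order_iso_lt fiso _.
  exists z => //; split=> //=; apply/fmono => //.
  by case: zb => fzb _; exact: ole_lt_trans fzb bfy.
case: zb => _ bfz; apply: ole_lt_trans bfz _; apply/fmono => //.
by split=> //=; exact: lt_trans zy yx.
Qed.

(** Cofinality of positions has to become metric approximation. If the points of rank [j] below [x]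
    stayed below [x - e], their supremum would lie in the closed set [S] and below [x], yet some
    such point would have a position above it. *)
Lemma limit_rankP f S gamma x j : closed S ->
  order_iso f (S `&` [set z | z < x]) gamma -> S x ->
  limit_rank j gamma <-> left_rank S j x.
Proof.
move=> clS; elim: j gamma x => [//|j IH] gamma x fiso Sx.
have [fmono fP] := fiso.
have IHy y : S y -> y < x -> limit_rank j (f y) <-> left_rank S j y.
  by move=> Sy yx; apply: IH => //; exact: order_iso_below fiso _ _.
split=> [[gamma0 lim]|[_ lim]]; split=> //.
- move=> e e0; apply: contrapT => ny.
  pose Y := [set y | left_rank S j y /\ y < x].
  have Yub y : Y y -> y <= x - e.
    move=> [ly yx]; rewrite leNgt; apply/negP => ey; apply: ny.
    by exists y => //; rewrite ey.
  have above b : olt b gamma -> exists2 y, Y y & olt b (f y).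
    move=> /lim[m [bm /fP[y [Sy /= yx] [fym mfy]] jm]].
    exists y; last exact: olt_le_trans bm mfy.
    by split=> //; apply/IHy => //; exact: limit_rank_eq jm.
  have supY : has_sup Y.
    split; first by have [y Yy _] := above _ gamma0; exists y.
    by exists (x - e) => y /Yub.
  have sx : sup Y <= x - e.
    by apply: ge_sup; [case: supY | move=> y /Yub].
  have Ss : S (sup Y).
    apply: clS; apply/closure_normP => d d0.
    have [y Yy sy] := sup_adherent d0 supY.
    exists y; first by case: Yy => /left_rank_mem.
    have ys : y <= sup Y by apply: ub_le_sup => //; case: supY.
    by rewrite ger0_norm ?subr_ge0 //; lra.
  have As : (S `&` [set z | z < x]) (sup Y) by split=> //=; lra.
  have [y Yy fsy] := above _ (order_iso_lt _ _ _ _ fiso As).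
  have : sup Y < y.
    by apply/fmono => //; case: Yy => /left_rank_mem.
  by rewrite ltNge ub_le_sup //; case: supY.
- have [y /left_rank_mem Sy /andP[_ yx]] := lim 1 ltr01.
  apply: ole_lt_trans (ole0 _) _.
  exact: (order_iso_lt _ _ _ y fiso (conj Sy yx)).
- move=> b /fP[z [Sz /= zx] [fzb bfz]].
  have [|y ly /andP[zy yx]] := lim (x - z); first by rewrite subr_gt0.
  have Sy := left_rank_mem _ _ _ ly.
  exists (f y); split.
  + apply: ole_lt_trans bfz _; apply/fmono => //.
    by move: zy; rewrite opprB addrC subrK.
  + exact: (order_iso_lt _ _ _ y fiso (conj Sy yx)).
  + exact/IHy.
Qed.

(** Rank [k.+1] at [eta] would write it as [defect m + i] with [i > k], against uniqueness of the
    integer. Rank [n > eta] occurs nowhere up to [eta], since such a point is at least [n]; this is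
    the bound needed for the normal form. *)
Lemma is_nth1_ord_is S q k alpha : closed S -> S `<=` closure (Dst R) ->
  stable q -> left_rank S k (defect R q + k%:R) ->
  is_nth1 S alpha (defect R q + k%:R) -> ord_is alpha (ofin k).
Proof.
set eta := defect R q + k%:R => clS SD sq lk [gamma alphaE [Seta [f fiso]]].
have [n etan] := natr_bound eta.
have bnd y : y <= eta -> ~ left_rank S n y.
  move=> yeta /(left_rankS _ _ _ _ SD)/left_rank_defect[m [i [[m0 _] ni yE]]].
  have := defect_ge0 m m0; have : n%:R <= i%:R :> R by rewrite ler_nat.
  by lra.
apply: ord_is_eq alphaE _; apply: (ord_is_limit_rank n).
- move=> m mg nm; have [mE|mlt] := ole_eqVlt _ _ mg.
    apply: (bnd eta) => //; apply/(limit_rankP f S gamma) => //.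
    exact: limit_rank_eq mE nm.
  have [y [Sy /= yeta] fym] := (fiso.2 m).1 mlt.
  apply: (bnd y); first exact: ltW.
  apply/(limit_rankP f S (f y)) => //; first exact: order_iso_below fiso _ _.
  exact: limit_rank_eq (oeq_sym _ _ fym) nm.
- exact: (limit_rankP f S gamma eta k clS fiso Seta).2 lk.
- move=> /(limit_rankP f S gamma _ _ clS fiso Seta).
  move=> /(left_rankS _ _ _ _ SD)/left_rank_defect[m [i [sm ki E]]].
  have := defectD_inj _ _ _ _ sq sm E; lia.
Qed.

End RealPart.

Theorem theorem4p4 (R : realType) (q k : nat) (eta : R)
  (hq : stable q) (heta : eta = defect R q + k%:R) :
  [/\ closure (Dst_mod R (complexity q + k)%N) eta,
      (forall alpha : Ord,
         is_nth1 (closure (Dst R)) alpha eta -> ord_is alpha (ofin k))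
    & (forall beta : Ord,
         is_nth1 (closure (Dst_mod R (complexity q + k)%N)) beta eta ->
         ord_is beta (ofin k))].
Proof.
have lk := left_rank_defectD R k q _ hq (erefl ((complexity q + k) %% 3)%N).
have sub : closure (Dst_mod R (complexity q + k)%N) `<=` closure (Dst R).
  by apply: closure_subset => x [n [_ sn _ ->]]; exists n.
rewrite {}heta; split=> [|alpha|beta]; first exact: left_rank_mem lk.
- apply: is_nth1_ord_is => //; first exact: closed_closure.
  exact: left_rankS lk.
- by apply: is_nth1_ord_is => //; exact: closed_closure.
Qed.
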